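(* Let $p>3$ be a prime. Then $$\sum_{k=0}^{p-1}(4k+1)^3\frac{\binom{2k}k^3}{(-64)^k}\equiv-3(-1)^{\frac{p-1}2}p+p^3(4-3E_{p-3})\pmod{p^4},$$ $$\sum_{k=0}^{p-1}(4k-1)\frac{\binom{2k}k^3}{(-64)^k(2k-1)^3}\equiv(-1)^{\frac{p-1}2}p+p^3(E_{p-3}-2)\pmod{p^4},$$ $$\sum_{k=0}^{p-1}(4k-1)^3\frac{\binom{2k}k^3}{(-64)^k(2k-1)^3}\equiv-3(-1)^{\frac{p-1}2}p+p^3(2-3E_{p-3})\pmod{p^4},$$ $$\sum_{k=0}^{p-1}(12k+1)\binom{-1/6}k^3\equiv\begin{cases}(-1)^{\frac{p-1}2}p+\frac59p^3E_{p-3}\pmod{p^4}&\text{if }3\mid p-1,\\5(-1)^{\frac{p-1}2}p+\frac{625}9p^3E_{p-3}\pmod{p^4}&\text{if }3\mid p-2,\end{cases}$$ $$\sum_{k=0}^{p-1}(12k+1)^3\binom{-1/6}k^3\equiv\begin{cases}-3(-1)^{\frac{p-1}2}p+p^3(4-\frac53E_{p-3})\pmod{p^4}&\text{if }3\mid p-1,\\-15(-1)^{\frac{p-1}2}p+p^3(500-\frac{625}3E_{p-3})\pmod{p^4}&\text{if }3\mid p-2,\end{cases}$$ $$\sum_{k=0}^{p-1}(6k+1)\binom{-1/3}k^3\equiv\begin{cases}p+p^3U_{p-3}\pmod{p^4}&\text{if }3\mid p-1,\\-2p+8p^3U_{p-3}\pmod{p^4}&\text{if }3\mid p-2,\end{cases}$$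 $$\sum_{k=0}^{p-1}(6k+1)^3\binom{-1/3}k^3\equiv\begin{cases}-3p+p^3(4-3U_{p-3})\pmod{p^4}&\text{if }3\mid p-1,\\6p+8p^3(4-3U_{p-3})\pmod{p^4}&\text{if }3\mid p-2.\end{cases}$$
   Context: The general binomial coefficient is $\binom a0=1$, $\binom ak=a(a-1)\cdots(a-k+1)/k!$ for $k\ge1$. Congruences are in the ring of rationals with denominators prime to $p$. The Euler numbers are $E_0=1$, $E_{2n-1}=0$, $E_{2n}=-\sum_{k=1}^n\binom{2n}{2k}E_{2n-2k}$ ($n\ge1$). The sequence $U_n$ is given by $U_0=1$, $U_{2n-1}=0$, $U_{2n}=-2\sum_{k=1}^n\binom{2n}{2k}U_{2n-2k}$ ($n\ge1$). *)

(* Defs.v *)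
From mathcomp Require Import all_boot all_order all_algebra.

Set Implicit Arguments.
Unset Strict Implicit.
Unset Printing Implicit Defensive.

Import Order.TTheory GRing.Theory Num.Theory.
Local Open Scope ring_scope.

Definition gbinom (a : rat) (k : nat) : rat :=
  (\prod_(0 <= i < k) (a - i%:R)) / (k`!)%:R.

Definition pintegral (p : nat) (x : rat) : bool := coprime p `|denq x|%N.

(* Congruence modulo p ^ m in the ring of p-integral rationals; both sides are
   required to lie in that ring. *)
Definition pcongr (p m : nat) (x y : rat) : Prop :=
  [/\ pintegral p x, pintegral p y &
      exists2 z : rat, pintegral p z & x - y = p%:R ^+ m * z].

(* [:: A_0; A_2; ...; A_(2n)] where A_0 = 1 and
   A_(2n) = - c * \sum_(1 <= k <= n) 'C(2n, 2k) * A_(2n-2k).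
   The list carries the earlier values, as the recursion is course-of-values;
   see even_rec_double for the recursion itself. *)
Fixpoint even_rec_seq (c : int) (n : nat) : seq int :=
  if n is m.+1 then
    let s := even_rec_seq c m in
    rcons s (- (c * \sum_(1 <= k < n.+1) ('C(2 * n, 2 * k))%:Z * s`_(n - k)))
  else [:: 1].

Definition even_rec (c : int) (n : nat) : int :=
  if odd n then 0 else (even_rec_seq c n./2)`_(n./2).

Definition euler_number : nat -> int := even_rec 1.
Definition U_number : nat -> int := even_rec 2.

Lemma size_even_rec_seq c n : size (even_rec_seq c n) = n.+1.
Proof. by elim: n => //= n IHn; rewrite size_rcons IHn. Qed.

Lemma nth_even_rec_seq c n j :
  (j <= n)%N -> (even_rec_seq c n)`_j = (even_rec_seq c j)`_j.
Proof.
elim: n => [|n IHn]; first by rewrite leqn0 => /eqP ->.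
rewrite leq_eqVlt => /predU1P [-> //|lt_jn].
by rewrite /= nth_rcons size_even_rec_seq lt_jn IHn.
Qed.

Lemma even_rec0 c : even_rec c 0 = 1.
Proof. by []. Qed.

Lemma even_rec_odd c n : (1 <= n)%N -> even_rec c (2 * n - 1) = 0.
Proof. by case: n => // n _; rewrite /even_rec mulnS addSn subSS subn0 /= mul2n odd_double. Qed.

Lemma even_rec_double c n : (1 <= n)%N ->
  even_rec c (2 * n) =
  - (c * \sum_(1 <= k < n.+1)
           ('C(2 * n, 2 * k))%:Z * even_rec c (2 * n - 2 * k)).
Proof.
case: n => // n _; rewrite {1}/even_rec mul2n odd_double doubleK /=.
rewrite nth_rcons size_even_rec_seq ltnn eqxx; congr (- (c * _)).
rewrite -mul2n; apply: eq_big_nat => k /andP [k_gt0 k_le].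
rewrite -mulnBr mul2n /even_rec !mul2n odd_double doubleK; congr (_ * _).
by apply: nth_even_rec_seq; rewrite leq_subLR -addn1 addnC leq_add2r.
Qed.

Lemma euler_number0 : euler_number 0 = 1.
Proof. by []. Qed.

Lemma euler_number_odd n : (1 <= n)%N -> euler_number (2 * n - 1) = 0.
Proof. exact: even_rec_odd. Qed.

Lemma euler_number_double n : (1 <= n)%N ->
  euler_number (2 * n) =
  - \sum_(1 <= k < n.+1)
      ('C(2 * n, 2 * k))%:Z * euler_number (2 * n - 2 * k).
Proof. by move=> n_gt0; rewrite /euler_number even_rec_double // mul1r. Qed.

Lemma U_number0 : U_number 0 = 1.
Proof. by []. Qed.

Lemma U_number_odd n : (1 <= n)%N -> U_number (2 * n - 1) = 0.
Proof. exact: even_rec_odd. Qed.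

Lemma U_number_double n : (1 <= n)%N ->
  U_number (2 * n) =
  - (2 * \sum_(1 <= k < n.+1)
           ('C(2 * n, 2 * k))%:Z * U_number (2 * n - 2 * k)).
Proof. exact: even_rec_double. Qed.

(* Main.v *)
(** Write [S(a)] for the sum of [(2k - a) * binom(a, k)^3] over [k < p].  By
    telescoping, [S(a) + S(a - 1) = (p - 2a) * binom(a - 1, p - 1)^3].  The
    cubic sums reduce to [S(a)], because
    [(2k - a)^3 + 3 a^2 (2k - a) = 4 (k^3 + (k - a)^3)] and
    [(a - k) * binom(a, k) = (k + 1) * binom(a, k + 1)], so that the sum of
    [((2k - a)^3 + 3 a^2 (2k - a)) * binom(a, k)^3] telescopes.

    For [a = m + p t] with [0 <= m < p], descending from [a] to [p t] gives
    [S(a) = (-1)^(m+1) p t + p^3 R] with [R] p-integral, and [R] mod [p] obeys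
    the same recurrence in [m] as [-4 t^3 Q(2m + 1)], where
    [Q(y) = \sum_k binom(p-3, k) E_k y^(p-3-k)] satisfies
    [Q(y + 1) + Q(y - 1) = 2 y^(p-3)]; here [2m + 1] is [2a + 1] mod [p].
    Finally [Q(0)], [Q(2)], [Q(2/3)], [Q(1/3)] are evaluated over [F_p]: any
    function [f] with [f(y + d) + f(y - d) = 0] vanishes, since [p] steps of
    length [2d] return to [y] after an odd number of sign changes. *)
Require Import Defs.
From HB Require Import structures.
From mathcomp Require Import all_boot all_order all_algebra.
From mathcomp Require Import ring zify.
Set Implicit Arguments.
Unset Strict Implicit.
Unset Printing Implicit Defensive.
Import Order.TTheory GRing.Theory Num.Theory.
Local Open Scope ring_scope.

(** * Sums of cubes of binomial coefficients *)

Lemma gbinom0 a : gbinom a 0 = 1.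
Proof. by rewrite /gbinom big_geq // fact0 divr1. Qed.

Lemma gbinomS a k : gbinom a k.+1 = gbinom a k * (a - k%:R) / k.+1%:R.
Proof.
rewrite /gbinom big_nat_recr //= factS natrM.
by rewrite invfM; ring.
Qed.

Lemma gbinom_absorb a k : gbinom a k.+1 = a * gbinom (a - 1) k / k.+1%:R.
Proof.
have e i : a - i.+1%:R = a - 1 - i%:R by rewrite -nat1r opprD addrA.
rewrite /gbinom big_nat_recl //= factS natrM subr0.
under eq_bigr do rewrite e.
by rewrite invfM; ring.
Qed.

Lemma gbinom_pred a k : gbinom a k * (a - k%:R) = a * gbinom (a - 1) k.
Proof.
have := gbinom_absorb a k; rewrite gbinomS.
by move/(divIf _); apply; rewrite pnatr_eq0.
Qed.

Definition gbsum (a : rat) (n : nat) : rat :=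
  \sum_(0 <= k < n) (2 * k%:R - a) * gbinom a k ^+ 3.

(** By [gbinom_absorb] and [gbinomS] both new summands are multiples of [binom(a - 1, n)^3], and
    their sum is the increment of the closed form. *)
Lemma gbsum_pred a n :
  gbsum a n.+1 + gbsum (a - 1) n.+1 =
  (n.+1%:R - 2 * a) * gbinom (a - 1) n ^+ 3.
Proof.
elim: n => [|n IHn]; first by rewrite /gbsum !big_nat1 !gbinom0; ring.
rewrite /gbsum !(big_nat_recr n.+1) //= -!/(gbsum _ _) addrACA IHn.
rewrite (gbinom_absorb a) (gbinomS (a - 1)).
move: (gbinom _ _) => c; rewrite -(natr1 n.+1).
have : n.+1%:R != 0 :> rat by rewrite pnatr_eq0.
by rewrite -(natr1 n) => n0; field.
Qed.

(** Apart from the [gbsum] term, each summand is the difference of [4 (k binom(a, k))^3] at [k] and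
    [k + 1]; the lower boundary term is zero. *)
Lemma gbsum_cube a n :
  \sum_(0 <= k < n) (2 * k%:R - a) ^+ 3 * gbinom a k ^+ 3 =
  - (3 * a ^+ 2 * gbsum a n) - 4 * (n%:R * gbinom a n) ^+ 3.
Proof.
elim: n => [|n IHn]; first by rewrite /gbsum !big_geq //; ring.
rewrite /gbsum !big_nat_recr //= -/(gbsum _ _) IHn gbinomS.
have : n.+1%:R != 0 :> rat by rewrite pnatr_eq0.
by rewrite -(natr1 n) => n0; field.
Qed.

(** * Central binomial coefficients as binomials at -1/2 and 1/2 *)

Lemma gbinom_Nhalf k : gbinom (- (1 / 2)) k = 'C(2 * k, k)%:R / (- 4) ^+ k.
Proof.
elim: k => [|k IHk]; first by rewrite gbinom0 muln0 bin0.
have e : (k.+1 * 'C(2 * k.+1, k.+1) = 2 * (2 * k).+1 * 'C(2 * k, k))%N.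
  have := mul_bin_diag (2 * k).+1 k; have := mul_bin_down (2 * k).+1 k.
  rewrite (_ : (2 * k).+1 - k = k.+1)%N /=; last lia.
  rewrite (_ : (2 * k.+1 = (2 * k).+2)%N); last lia.
  by rewrite (binS (2 * k).+1); lia.
have n0 : k.+1%:R != 0 :> rat by rewrite pnatr_eq0.
apply: (mulfI n0); rewrite gbinomS IHk [RHS]mulrA -natrM e !natrM exprS.
rewrite -(natr1 (2 * k)) natrM; rewrite -(natr1 k) in n0 *.
by field; rewrite expf_eq0 n0 andbF.
Qed.

(** [gbinom_pred] at [1/2] reduces to the value at [-1/2]; dividing by [1/2 - k] is allowed because
    [2k] is never 1. *)
Lemma gbinom_half k :
  gbinom (1 / 2) k = - ('C(2 * k, k)%:R / ((- 4) ^+ k * (2 * k%:R - 1))).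
Proof.
have := gbinom_pred (1 / 2) k.
rewrite (_ : 1 / 2 - 1 = - (1 / 2)); last by field.
rewrite gbinom_Nhalf => e.
have n0 : 2 * k%:R - 1 != 0 :> rat.
  rewrite subr_eq0; apply/eqP => /eqP; rewrite -natrM -[1]/(1%:R) eqr_nat => /eqP; lia.
have n1 : 1 / 2 - k%:R != 0 :> rat.
  apply: contra n0 => /eqP n1; rewrite (_ : _ - 1 = - (2 * (1 / 2 - k%:R))); last by field.
  by rewrite n1 mulr0 oppr0.
apply: (mulIf n1); rewrite e; field; rewrite n0 /=.
by rewrite expf_eq0 andbF.
Qed.

(** * Reduction modulo p of p-integral rationals *)

(** The reduced denominator divides every denominator of [x]. *)
Lemma pintegral_den p (x : rat) (n : int) (d : nat) :
  coprime p d -> x * d%:R = n%:~R -> pintegral p x.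
Proof.
move=> cpd e; have dv : (denq x %| d%:Z)%Z.
  have : numq x * d%:Z = n * denq x.
    apply: (@intr_inj rat); rewrite !rmorphM /= -e numqE -!pmulrn; ring.
  move=> e1; have : (denq x %| numq x * d%:Z)%Z by rewrite e1 dvdz_mull.
  rewrite Gauss_dvdzr // /coprimez gcdzC /gcdz eqz_nat.
  exact: coprime_num_den.
by apply: coprime_dvdr cpd; move: dv; rewrite dvdzE.
Qed.

Lemma rat_mul_absz_denq x : x * `|denq x|%:R = (numq x)%:~R :> rat.
Proof. by rewrite numqE pmulrn abszE gtr0_norm. Qed.

Lemma pintegral_subring p : subring_closed (pintegral p).
Proof.
have pD (x y : rat) : pintegral p x -> pintegral p y ->
    coprime p (`|denq x| * `|denq y|)%N.
  by rewrite /pintegral coprimeMr => -> ->.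
split=> [|x y px py|x y px py].
- exact: (@pintegral_den _ _ 1 1 (coprimen1 _)).
- apply: pintegral_den (numq x * `|denq y|%N - numq y * `|denq x|%N) _ (pD _ _ px py) _.
  rewrite rmorphB !rmorphM /= -!rat_mul_absz_denq -!pmulrn; ring.
- apply: pintegral_den (numq x * numq y) _ (pD _ _ px py) _.
  by rewrite !rmorphM /= -!rat_mul_absz_denq; ring.
Qed.
HB.instance Definition _ p :=
  GRing.isSubringClosed.Build rat (pintegral p) (pintegral_subring p).

Lemma pintegral_natV p d : coprime p d -> (d%:R : rat)^-1 \in pintegral p.
Proof.
case: d => [|d] cpd; first by rewrite invr0 rpred0.
by apply: (@pintegral_den _ _ 1 d.+1 cpd); rewrite mulVf ?pnatr_eq0.
Qed.

Section Reduction.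

Variables (p : nat) (p_prime : prime p).

(* [ratr] is a ring morphism only on the p-integral rationals here: elsewhere it
   divides by 0 in ['F_p]. *)
Local Notation red := (@ratr 'F_p).

Lemma Fp_int_eq0 (d : int) : (d%:~R == 0 :> 'F_p) = (p %| d)%Z.
Proof. by rewrite (dvdz_pcharf (pchar_Fp p_prime)). Qed.

Lemma pintegralE x : pintegral p x = ((denq x)%:~R != 0 :> 'F_p).
Proof. by rewrite Fp_int_eq0 /pintegral prime_coprime. Qed.

(** Any fraction for [x] whose denominator is a unit mod [p] computes the reduction, not only the
    one in lowest terms. *)
Lemma redE (x : rat) (n d : int) :
  x \in pintegral p -> d%:~R != 0 :> 'F_p -> x * d%:~R = n%:~R ->
  red x = n%:~R / d%:~R.
Proof.
rewrite [x \in _]pintegralE => px d0 e; apply/eqP; rewrite eqr_div //.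
rewrite -!intrM; apply/eqP; congr (_ %:~R); apply: (@intr_inj rat).
by rewrite !rmorphM /= -e numqE; ring.
Qed.

Lemma redM : {in pintegral p &, {morph red : x y / x * y}}.
Proof.
move=> x y px py; rewrite /= (@redE _ (numq x * numq y) (denq x * denq y)).
- by rewrite /ratr !intrM; field; rewrite -!pintegralE; apply/andP.
- exact: rpredM.
- by rewrite intrM mulf_neq0 // -pintegralE.
- by rewrite !rmorphM /= !numqE; ring.
Qed.

Lemma redB : {in pintegral p &, {morph red : x y / x - y}}.
Proof.
move=> x y px py.
rewrite /= (@redE _ (numq x * denq y - numq y * denq x) (denq x * denq y)).
- by rewrite /ratr intrB !intrM; field; rewrite -!pintegralE; apply/andP.
- exact: rpredB.
- by rewrite intrM mulf_neq0 // -pintegralE.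
- by rewrite rmorphB !rmorphM /= !numqE; ring.
Qed.

Lemma red0 : red 0 = 0. Proof. exact: (ratr_nat _ 0). Qed.

Lemma red1 : red 1 = 1. Proof. exact: (ratr_nat _ 1). Qed.

Lemma redN : {in pintegral p, {morph red : x / - x}}.
Proof. by move=> x px; rewrite /= -sub0r redB ?rpred0 // red0 sub0r. Qed.

Lemma redD : {in pintegral p &, {morph red : x y / x + y}}.
Proof.
by move=> x y px py; rewrite /= -[y]opprK redB ?redN ?rpredN // opprK.
Qed.

Lemma redX n : {in pintegral p, {morph red : x / x ^+ n}}.
Proof.
move=> x px; elim: n => [|n IHn]; first by rewrite !expr0 red1.
by rewrite !exprS redM ?IHn // rpredX.
Qed.

Lemma redV : {in pintegral p, forall x, red x != 0 ->
  x^-1 \in pintegral p /\ red x^-1 = (red x)^-1}.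
Proof.
move=> x px rx.
have n0 : (numq x)%:~R != 0 :> 'F_p.
  by apply: contra rx => /eqP n0; rewrite /ratr n0 mul0r.
have x0 : x != 0 by apply: contra rx => /eqP ->; rewrite red0.
have px1 : x^-1 \in pintegral p.
  (* [pintegral_den] takes a natural denominator, so the sign of [numq x] moves into the new
     numerator. *)
  apply: (@pintegral_den _ _ (Num.sg (numq x) * denq x) `|numq x|%N).
    by rewrite prime_coprime //; move: n0; rewrite Fp_int_eq0 dvdzE.
  rewrite pmulrn abszE normrEsg !rmorphM /= numqE.
  by rewrite mulrCA mulKf.
split=> //; apply: (mulfI rx).
by rewrite -redM // divff // divff // red1.
Qed.

(** A zero residue means that [p] divides the numerator; cancelling it leaves the denominator prime
    to [p]. *)
Lemma red_eq0 x : x \in pintegral p -> red x = 0 ->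
  exists2 z, z \in pintegral p & x = p%:R * z.
Proof.
move=> px /eqP; rewrite mulf_eq0 invr_eq0 -[X in _ || X]negbK -pintegralE (px : pintegral p x) orbF.
rewrite Fp_int_eq0 => /dvdzP [q e].
exists (q%:~R / (denq x)%:~R).
  apply: rpredM; first exact: rpred_int.
  by rewrite -[denq x]gez0_abs ?denq_ge0 // -pmulrn pintegral_natV.
by rewrite -[LHS]divq_num_den e intrM -pmulrn; ring.
Qed.

(** Integrality and residue travel together, so residues of compound expressions follow by composing
    the closure lemmas below. *)
Definition has_residue (x : rat) (u : 'F_p) := x \in pintegral p /\ red x = u.

Lemma eq_residue x u v : has_residue x u -> u = v -> has_residue x v.
Proof. by move=> ? <-. Qed.

Lemma residue_int (n : int) : has_residue n%:~R n%:~R.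
Proof. by split; [exact: rpred_int | exact: ratr_int]. Qed.

Lemma residue_nat (n : nat) : has_residue n%:R n%:R.
Proof. exact: (residue_int n). Qed.

Lemma residueM x y u v :
  has_residue x u -> has_residue y v -> has_residue (x * y) (u * v).
Proof. by move=> [px <-] [py <-]; split; [exact: rpredM | exact: redM]. Qed.

Lemma residueD x y u v :
  has_residue x u -> has_residue y v -> has_residue (x + y) (u + v).
Proof. by move=> [px <-] [py <-]; split; [exact: rpredD | exact: redD]. Qed.

Lemma residueN x u : has_residue x u -> has_residue (- x) (- u).
Proof. by move=> [px <-]; split; [rewrite rpredN | exact: redN]. Qed.

Lemma residueX n x u : has_residue x u -> has_residue (x ^+ n) (u ^+ n).
Proof. by move=> [px <-]; split; [exact: rpredX | exact: redX]. Qed.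

Lemma residueV x u : has_residue x u -> u != 0 -> has_residue x^-1 u^-1.
Proof. by move=> [px <-]; exact: redV. Qed.

Lemma residue_sum m n (F : nat -> rat) (G : nat -> 'F_p) :
  (forall i, (m <= i < n)%N -> has_residue (F i) (G i)) ->
  has_residue (\sum_(m <= i < n) F i) (\sum_(m <= i < n) G i).
Proof.
move=> FG; rewrite big_nat_cond [X in has_residue _ X]big_nat_cond.
elim/big_rec2: _ => [|i u x /andP[mn _]]; first exact: (residue_nat 0).
by apply: residueD; exact: FG.
Qed.

Lemma residue_neq0 x u : has_residue x u -> u != 0 -> x != 0.
Proof. by case=> _ <-; apply: contraNneq => ->; rewrite red0. Qed.

(** Elements with equal residues differ by a multiple of [p], so the factor [p^m] lifts an identity
    in ['F_p] to a congruence mod [p^(m+1)]; it is applied with [m = 3]. *)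
Lemma pcongr_residue (m : nat) X a b u : X \in pintegral p ->
  has_residue a u -> has_residue b u ->
  pcongr p m.+1 (X + p%:R ^+ m * a) (X + p%:R ^+ m * b).
Proof.
move=> pX [pa ua] [pb ub].
have [||z pz e] := @red_eq0 (a - b); first exact: rpredB.
  by rewrite redB // ua ub subrr.
split; last exists z => //; try exact: (rpredD pX (rpredM (rpredX _ (rpred_nat _ _)) _)).
by rewrite exprSr -mulrA -e; ring.
Qed.

End Reduction.

(** * Appell polynomials of the Euler numbers and of U *)

(** Trinomial revision: times [k! i! (n - i)!] both sides are [(n + k)!]; for [i > n] both
    vanish. *)
Lemma bin_bin n k i : ('C(n + k, k + i) * 'C(k + i, k) = 'C(n + k, k) * 'C(n, i))%N.
Proof.
have [le_in|lt_ni] := leqP i n; last first.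
  by rewrite (@bin_small (n + k)) ?(@bin_small n i) ?muln0 //; lia.
apply/eqP; rewrite -(@eqn_pmul2r (k`! * i`! * (n - i)`!)) ?muln_gt0 ?fact_gt0 //.
have e1 := @bin_fact (n + k) (k + i); have e2 := @bin_fact (k + i) k.
have e3 := @bin_fact (n + k) k; have e4 := @bin_fact n i.
have s1 : (n + k - (k + i) = n - i)%N by lia.
have s2 : (k + i - k = i)%N by lia.
have s3 : (n + k - k = n)%N by lia.
rewrite s1 in e1; rewrite s2 in e2; rewrite s3 in e3.
have {}e1 := e1 ltac:(lia); have {}e2 := e2 ltac:(lia).
have {}e3 := e3 ltac:(lia); have {}e4 := e4 le_in.
apply/eqP; transitivity (n + k)`!.
  by rewrite -e1 -e2; ring.
by rewrite -e3 -e4; ring.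
Qed.

(** The binomial theorem with its index shifted by [k], so that the range of [j] does not depend on
    [k] and sums can be exchanged; terms with [j < k] vanish. *)
Lemma binom_shift (R : comRingType) (x y : R) n k : (k <= n)%N ->
  (x + y) ^+ (n - k) *+ 'C(n, k) =
  \sum_(j < n.+1) x ^+ (n - j) * y ^+ (j - k) *+ ('C(n, j) * 'C(j, k)).
Proof.
move=> le_kn; rewrite -(subnK le_kn); move: (n - k)%N => l {n le_kn}.
rewrite addnK -(big_mkord xpredT (fun j => x ^+ (l + k - j) * y ^+ (j - k) *+
  ('C(l + k, j) * 'C(j, k)))) (@big_cat_nat _ _ _ k) //=; last lia.
rewrite big_nat_cond big1 ?add0r => [|j /andP[/andP[_ lt_jk] _]]; last first.
  by rewrite (bin_small lt_jk) muln0.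
have := big_addn 0 (l + k).+1 k xpredT (fun j => x ^+ (l + k - j) * y ^+ (j - k) *+
  ('C(l + k, j) * 'C(j, k))).
move=> /(_ 0 +%R); rewrite add0n => ->; rewrite (_ : (l + k).+1 - k = l.+1)%N; last lia.
rewrite big_mkord exprDn -sumrMnl; apply: eq_bigr => i _.
rewrite addnK [(i + k)%N]addnC bin_bin -mulrnA mulnC.
by rewrite (_ : (l + k - (k + i) = l - i)%N) //; lia.
Qed.

Lemma sum_nat_even (V : nmodType) (F : nat -> V) n :
  (forall i, odd i -> F i = 0) ->
  \sum_(0 <= k < (2 * n).+1) F k = \sum_(0 <= k < n.+1) F (2 * k)%N.
Proof.
move=> Fodd; elim: n => [|n IHn]; first by rewrite !big_nat1.
rewrite mulnS !add2n !(big_nat_recr _.+1) //= IHn (Fodd (2 * n).+1) ?addr0.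
  by rewrite mulnS.
by rewrite /= mul2n odd_double.
Qed.

(** The recursion without a parity split: [1 + (-1)^(n-k)] doubles the indices of the parity of [n]
    and kills the others. The term [k = n] turns [-1] into [c - 1]; the last summand accounts for
    the initial value at [n = 0]. *)
Lemma even_rec_sum (c : int) (n : nat) :
  c * \sum_(0 <= k < n.+1) 'C(n, k)%:R * (1 + (-1) ^+ (n - k)) * even_rec c k =
  2 * ((c - 1) * even_rec c n + (n == 0%N)%:R).
Proof.
rewrite big_nat_rev /= add0n.
have e : \sum_(0 <= k < n.+1)
    'C(n, n.+1 - k.+1)%:R * (1 + (-1) ^+ (n - (n.+1 - k.+1))) * even_rec c (n.+1 - k.+1)
  = \sum_(0 <= k < n.+1) 'C(n, k)%:R * (1 + (-1) ^+ k) * even_rec c (n - k).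
  apply: eq_big_nat => k /andP[_ le_kn]; rewrite subSS bin_sub // subKn //.
rewrite e {e}; have [on|en] := boolP (odd n).
  rewrite /even_rec on big1_seq ?mulr0 => [|k]; last first.
    rewrite mem_index_iota /= => le_kn; rewrite oddB // on addTb.
    by case: ifP => [_|/negbFE]; rewrite ?mulr0 // -signr_odd => ->; rewrite subrr mulr0 mul0r.
  by case: n on.
rewrite -(even_halfK en) -mul2n; move: (n./2) => {en}n.
rewrite sum_nat_even => [|k ok]; last by rewrite -signr_odd ok subrr mulr0 mul0r.
under eq_bigr => k _ do
  rewrite exprM sqrrN !expr1n mulrAC.
rewrite -mulr_suml big_ltn // muln0 bin0 mul1r subn0.
case: n => [|n]; first by rewrite big_geq //= /even_rec /=; ring.
rewrite addr0.
have := @even_rec_double c n.+1 isT.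
under [X in _ = - (c * X)]eq_bigr do rewrite -natz.
by move: (\sum_(1 <= k < n.+2) _) => s ->; ring.
Qed.

(** Exponential generating function [exp(y t) / (1 - c + c cosh t)]: [c = 1] gives the [Q] of the
    overview, [c = 2] its analogue for U. *)
Definition appell (R : comRingType) (c : int) (n : nat) (y : R) : R :=
  \sum_(k < n.+1) (even_rec c k)%:~R * y ^+ (n - k) *+ 'C(n, k).

(** Expanding with [binom_shift] and exchanging sums, the coefficient of [y^(n-j)] is [binom(n, j)]
    times the sum in [even_rec_sum] for [j]. *)
Lemma appell_shift (R : comRingType) c n (y : R) :
  c%:~R * (appell c n (y + 1) + appell c n (y - 1)) =
  2 * ((c - 1)%:~R * appell c n y + y ^+ n).
Proof.
rewrite /appell -big_split /=.
have e (k : 'I_n.+1) : (even_rec c k)%:~R * (y + 1) ^+ (n - k) *+ 'C(n, k) +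
     (even_rec c k)%:~R * (y - 1) ^+ (n - k) *+ 'C(n, k) =
  \sum_(j < n.+1) y ^+ (n - j) * 'C(n, j)%:R *
    ('C(j, k)%:R * (1 + (-1) ^+ (j - k)) * even_rec c k)%:~R.
  rewrite -!mulrnAr !binom_shift -1?ltnS // -mulrDr -big_split mulr_sumr /=.
  apply: eq_bigr => j _; rewrite expr1n mulr1 -[in LHS]mulr_natr -[X in _ + X]mulr_natr.
  by rewrite natrM !intrM rmorphD rmorphXn /= rmorphN1 -!pmulrn; ring.
rewrite (eq_bigr _ (fun k _ => e k)) exchange_big /= mulr_sumr.
have e2 (j : 'I_n.+1) : c%:~R * (\sum_(k < n.+1) y ^+ (n - j) * 'C(n, j)%:R *
    ('C(j, k)%:R * (1 + (-1) ^+ (j - k)) * even_rec c k)%:~R) =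
   2 * ((c - 1)%:~R * ((even_rec c j)%:~R * y ^+ (n - j) *+ 'C(n, j)) +
    (if val j == 0%N then y ^+ n else 0)).
  rewrite -mulr_sumr -rmorph_sum /=.
  have -> : \sum_(k < n.+1) 'C(j, k)%:R * (1 + (-1) ^+ (j - k)) * even_rec c k =
    \sum_(0 <= k < j.+1) 'C(j, k)%:R * (1 + (-1) ^+ (j - k)) * even_rec c k.
    rewrite -(big_mkord xpredT (fun k => 'C(j, k)%:R * (1 + (-1) ^+ (j - k)) * even_rec c k)).
    rewrite (@big_cat_nat _ _ _ j.+1) //= [X in _ + X]big_nat_cond.
    rewrite [X in _ + X]big1 ?addr0 // => k /andP[/andP[lt_jk _] _].
    by rewrite bin_small // !mul0r.
  rewrite mulrCA -intrM even_rec_sum.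
  case: eqP => [->|_].
    by rewrite /= subn0 bin0 mulr1n; ring.
  by rewrite -[_ *+ _]mulr_natr !addr0; ring.
rewrite (eq_bigr _ (fun k _ => e2 k)) -mulr_sumr big_split /= -mulr_sumr; congr (2 * (_ + _)).
rewrite big_ord_recl /= big1 ?addr0 //.
Qed.

Lemma appell0 (R : comRingType) c n : appell c n (0 : R) = (even_rec c n)%:~R.
Proof.
rewrite /appell big_ord_recr /= subnn mulr1 binn mulr1n big1 ?add0r // => i _.
by rewrite expr0n subn_eq0 leqNgt ltn_ord mulr0 mul0rn.
Qed.

Lemma appellN (R : comRingType) c n (y : R) : ~~ odd n -> appell c n (- y) = appell c n y.
Proof.
move=> en; apply: eq_bigr => k _; have [ok|ek] := boolP (odd k).
  by rewrite /even_rec ok !mul0r.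
by rewrite exprNn -signr_odd oddB -1?ltnS // (negbTE en) (negbTE ek) mul1r.
Qed.

(** * Special values of the Appell polynomials in characteristic p *)

Section PrimeCharacteristic.

Variables (F : fieldType) (p : nat).
Hypotheses (charFp : p \in [pchar F]) (p_gt3 : (3 < p)%N).

Let p_prime : prime p := pcharf_prime charFp.
Local Notation n := (p - 3)%N.
Local Notation Q := (@appell F 1 n).
Local Notation W := (@appell F 2 n).

Lemma pchar_natr_neq0 d : (0 < d < p)%N -> d%:R != 0 :> F.
Proof.
by case/andP=> d0 dp; rewrite -(dvdn_pcharf charFp) gtnNdvd.
Qed.

Let two_neq0 : 2 != 0 :> F. Proof. by apply: pchar_natr_neq0; lia. Qed.
Let three_neq0 : 3 != 0 :> F. Proof. by apply: pchar_natr_neq0; lia. Qed.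

Lemma odd_pchar : odd p.
Proof. by case: (even_prime p_prime) p_gt3 => // ->. Qed.

Lemma even_pcharB3 : ~~ odd n.
Proof. by rewrite oddB ?odd_pchar //; lia. Qed.

(** Fermat: [d^(n+3) = d^p = d]. *)
Lemma natr_expB3 d : d%:R != 0 :> F -> d%:R ^+ n = d%:R ^- 2 :> F.
Proof.
move=> d0; apply: (mulIf (expf_neq0 3 d0)); rewrite -exprD subnK; last lia.
by rewrite -(pFrobenius_autE charFp) pFrobenius_aut_nat; field.
Qed.

(* [p] is odd and [y + 2 * d * p = y], so iterating gives [f y = - f y]. *)
Lemma antiperiodic_eq0 (f : F -> F) (d : F) :
  (forall y, f (y + d) + f (y - d) = 0) -> forall y, f y = 0.
Proof.
move=> fd y; have it i : f (y + 2 * d * i%:R) = (-1) ^+ i * f y.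
  elim: i => [|i IHi]; first by rewrite mulr0 addr0 mul1r.
  rewrite exprS -[RHS]mulrA -IHi mulN1r; apply: (addIr (f (y + 2 * d * i%:R))).
  rewrite addNr -[RHS](fd (y + 2 * d * i%:R + d)) -nat1r.
  by congr (f _ + f _); ring.
have := it p; rewrite (pcharf0 charFp) mulr0 addr0 -signr_odd odd_pchar mulN1r.
move/eqP; rewrite -addr_eq0 -mulr2n -mulr_natl mulf_eq0 (negbTE two_neq0).
by move/eqP.
Qed.

Lemma appell1_shift y : Q (y + 1) + Q (y - 1) = 2 * y ^+ n.
Proof. by have := appell_shift 1 n y; rewrite subrr !mul0r mul1r add0r. Qed.

Lemma appell2_shift y : W (y + 1) + W (y - 1) = W y + y ^+ n.
Proof.
by have := appell_shift 2 n y; rewrite (_ : 2 - 1 = 1 :> int) // mul1r => /(mulfI two_neq0).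
Qed.

(** The shift relation at 0, where [Q] is even and [0^n = 0] since [n > 0]. It starts the recurrence
    in [gbsum_residue]. *)
Lemma appell1_1 : Q 1 = 0.
Proof.
have := appell1_shift 0; rewrite sub0r add0r (appellN _ _ even_pcharB3).
rewrite expr0n (_ : (n == 0)%N = false); last lia.
rewrite mulr0 -mulr2n -mulr_natl => /eqP.
by rewrite mulf_eq0 (negbTE two_neq0) => /eqP.
Qed.

Lemma appell1_2 : Q 2 = 2 - Q 0.
Proof.
have := appell1_shift 1; rewrite subrr -mulr2n => e.
by rewrite -[Q 2](addrK (Q 0)) e expr1n mulr1.
Qed.

(** Multiplication formula [Q(3y) = 3^n (Q(y - 2/3) - Q(y) + Q(y + 2/3))], as the difference of its
    sides is antiperiodic. At [y = 0], by evenness and [3^n = 1/9], it reads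
    [9 Q(0) = 2 Q(2/3) - Q(0)]. *)
Lemma appell1_two_thirds : Q (2 / 3) = 5 * Q 0.
Proof.
pose f y := Q (3 * y) - 3 ^+ n * (Q (y - 2 / 3) - Q y + Q (y + 2 / 3)).
have f0 : f 0 = 0.
  apply: (@antiperiodic_eq0 f (1 / 3)) => y; rewrite /f.
  have -> : 3 * (y + 1 / 3) = 3 * y + 1 by field.
  have -> : 3 * (y - 1 / 3) = 3 * y - 1 by field.
  have -> : y + 1 / 3 - 2 / 3 = y - 1 / 3 by field.
  have -> : y - 1 / 3 + 2 / 3 = y + 1 / 3 by field.
  have -> : y + 1 / 3 + 2 / 3 = y + 1 by field.
  have -> : y - 1 / 3 - 2 / 3 = y - 1 by field.
  have e1 := appell1_shift (3 * y); have e2 := appell1_shift y.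
  rewrite exprMn in e1.
  transitivity (Q (3 * y + 1) + Q (3 * y - 1) - 3 ^+ n * (Q (y + 1) + Q (y - 1))).
    by ring.
  by rewrite e1 e2; ring.
move: f0; rewrite /f mulr0 sub0r add0r (appellN _ _ even_pcharB3) natr_expB3 //.
move/eqP; rewrite subr_eq0 => /eqP e.
have -> : Q (2 / 3) = (3 ^+ 2 * (3 ^- 2 * (Q (2 / 3) - Q 0 + Q (2 / 3))) + Q 0) / 2.
  by rewrite (mulVKf (expf_neq0 2 three_neq0)); field.
by rewrite -e; field.
Qed.

Lemma appell1_third : Q (1 / 3) = 9 / 4 * W 0.
Proof.
(* [2 / 9 = 3 ^+ n / 2 ^+ n.+1] since [d ^+ n = d ^- 2]; the shift operators satisfy
   [(T - 1 + T^-1) * (T^(1/2) + T^(-1/2)) = T^(3/2) + T^(-3/2)]. *)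
pose f y := W y - 2 / 9 * (Q (2 / 3 * y + 1 / 3) + Q (2 / 3 * y - 1 / 3)).
have two3 : 6 != 0 :> F by rewrite (natrM _ 2 3) mulf_neq0.
have nine : 9 != 0 :> F by rewrite (natrM _ 3 3) mulf_neq0.
have four : 4 != 0 :> F by rewrite (natrM _ 2 2) mulf_neq0.
have f0 : f 0 = 0.
  apply: (@antiperiodic_eq0 f (3 / 2)) => y; rewrite /f.
  have e1 := appell2_shift (y + 1 / 2); have e2 := appell2_shift (y - 1 / 2).
  have e3 := appell1_shift (2 / 3 * (y + 1 / 2)).
  have e4 := appell1_shift (2 / 3 * (y - 1 / 2)).
  rewrite !exprMn exprVn !natr_expB3 // in e3 e4.
  have h1 : y + 1 / 2 + 1 = y + 3 / 2 by field.
  have h2 : y + 1 / 2 - 1 = y - 1 / 2 by field.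
  have h3 : y - 1 / 2 + 1 = y + 1 / 2 by field.
  have h4 : y - 1 / 2 - 1 = y - 3 / 2 by field.
  rewrite h1 h2 in e1; rewrite h3 h4 in e2.
  have -> : 2 / 3 * (y + 3 / 2) + 1 / 3 = 2 / 3 * (y + 1 / 2) + 1.
    by field; rewrite ?two_neq0 ?three_neq0 ?two3 ?nine ?four ?oner_neq0.
  have -> : 2 / 3 * (y + 3 / 2) - 1 / 3 = 2 / 3 * (y - 1 / 2) + 1.
    by field; rewrite ?two_neq0 ?three_neq0 ?two3 ?nine ?four ?oner_neq0.
  have -> : 2 / 3 * (y - 3 / 2) + 1 / 3 = 2 / 3 * (y + 1 / 2) - 1.
    by field; rewrite ?two_neq0 ?three_neq0 ?two3 ?nine ?four ?oner_neq0.
  have -> : 2 / 3 * (y - 3 / 2) - 1 / 3 = 2 / 3 * (y - 1 / 2) - 1.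
    by field; rewrite ?two_neq0 ?three_neq0 ?two3 ?nine ?four ?oner_neq0.
  (* Grouped for [e1] to [e4]: the [W] values cancel down to [(y + 1/2)^n + (y - 1/2)^n], and the
     [Q] part equals this because [(2/3)^n = 9/4]. *)
  transitivity ((W (y + 3 / 2) + W (y - 1 / 2)) + (W (y + 1 / 2) + W (y - 3 / 2))
     - W (y - 1 / 2) - W (y + 1 / 2) - 2 / 9 * (
     (Q (2 / 3 * (y + 1 / 2) + 1) + Q (2 / 3 * (y + 1 / 2) - 1)) +
     (Q (2 / 3 * (y - 1 / 2) + 1) + Q (2 / 3 * (y - 1 / 2) - 1)))).
    by ring.
  rewrite e1 e2 e3 e4; move: (_ ^+ n) (_ ^+ n) => a b; field.
  by rewrite ?two_neq0 ?three_neq0 ?two3 ?nine ?four ?oner_neq0.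
(* At 0, evenness of [Q] gives [W 0 = 4/9 Q(1/3)]. *)
move: f0; rewrite /f mulr0 sub0r add0r (appellN _ _ even_pcharB3).
move/eqP; rewrite subr_eq0 => /eqP ->.
by field; rewrite ?two_neq0 ?three_neq0 ?two3 ?nine ?four ?oner_neq0.
Qed.

(** The reflection of [k] to [p - k] preserves [k^2] mod [p] and, [p] being odd, flips the sign. *)
Lemma alternating_sum_inv_sq :
  \sum_(1 <= k < p) (-1) ^+ k.+1 / k%:R ^+ 2 = 0 :> F.
Proof.
set s := \sum_(_ <= _ < _) _.
have : s = - s.
  rewrite {1}/s big_nat_rev -sumrN /=; apply: eq_big_nat => k /andP[k0 kp].
  rewrite add1n subSS natrB ?(ltnW kp) // (pcharf0 charFp) sub0r sqrrN -mulNr.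
  congr (_ / _); rewrite -signr_odd -[in RHS]signr_odd /= oddB ?(ltnW kp) // odd_pchar.
  by case: (odd k); rewrite ?opprK.
move/eqP; rewrite -addr_eq0 -mulr2n -mulr_natl mulf_eq0 (negbTE two_neq0).
by move/eqP.
Qed.

End PrimeCharacteristic.

(** * The congruences modulo p^4 *)

Section Main.

Variables (p : nat) (p_prime : prime p) (p_gt3 : (3 < p)%N).

Local Notation has_residue := (@has_residue p).
Local Notation Q := (@appell 'F_p 1 (p - 3)).

Let charFp : p \in [pchar 'F_p] := pchar_Fp p_prime.

Lemma Fp_natr_neq0 d : (0 < d < p)%N -> d%:R != 0 :> 'F_p.
Proof. exact: pchar_natr_neq0. Qed.

(** Modulo [p] this is [binom(-1, k)]; [k < p] keeps the denominators invertible. *)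
Lemma gbinom_pred_residue t u k : has_residue t u -> (k < p)%N ->
  has_residue (gbinom (p%:R * t - 1) k) ((-1) ^+ k).
Proof.
move=> tu; elim: k => [|k IHk] kp; first by rewrite gbinom0; exact: residue_nat 1.
have k0 : k.+1%:R != 0 :> 'F_p by apply: Fp_natr_neq0; rewrite kp.
have := residueM p_prime (residueM p_prime (IHk (ltnW kp)) (residueD p_prime
  (residueD p_prime (residueM p_prime (residue_nat p p) tu) (residueN p_prime (residue_nat p 1)))
  (residueN p_prime (residue_nat p k)))) (residueV p_prime (residue_nat p k.+1) k0).
rewrite -gbinomS => h; apply: eq_residue h _.
rewrite (pcharf0 charFp) mul0r add0r -opprD nat1r mulrN mulNr mulfK //.
by rewrite exprS mulN1r.
Qed.

(** Here [p!] is not invertible mod [p]. For [m = 0] the factor [p] cancels explicitly in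
    [binom(p t, p) = t binom(p t - 1, p - 1)]; each later step multiplies by [a / (a - p)], of
    residue 1. *)
Lemma gbinom_residue t u m : has_residue t u -> (m < p)%N ->
  has_residue (gbinom (m%:R + p%:R * t) p) u.
Proof.
move=> tu; have p0 := prime_gt0 p_prime.
have pQ : p%:R != 0 :> rat by rewrite pnatr_eq0 -lt0n.
elim: m => [|m IHm] mp.
  have := gbinom_absorb (p%:R * t) p.-1; rewrite prednK // => e.
  rewrite add0r e (_ : _ / _ = t * gbinom (p%:R * t - 1) p.-1); last by field.
  have pp : (p.-1 < p)%N by rewrite prednK.
  apply: eq_residue (residueM p_prime tu (gbinom_pred_residue tu pp)) _.
  rewrite -signr_odd; have := odd_pchar charFp p_gt3.
  by rewrite -{1}(prednK p0) /= => /negbTE ->; rewrite mulr1.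
have m0 : m.+1%:R != 0 :> 'F_p by apply: Fp_natr_neq0; rewrite mp.
have ra := residueD p_prime (residue_nat p m.+1) (residueM p_prime (residue_nat p p) tu).
rewrite (pcharf0 charFp) mul0r addr0 in ra.
have rb := residueD p_prime ra (residueN p_prime (residue_nat p p)).
rewrite (pcharf0 charFp) subr0 in rb.
have b0 := residue_neq0 rb m0.
have := gbinom_pred (m.+1%:R + p%:R * t) p.
rewrite (_ : m.+1%:R + p%:R * t - 1 = m%:R + p%:R * t); last by rewrite -natr1; ring.
move=> /(canRL (mulfK b0)) ->.
apply: eq_residue (residueM p_prime (residueM p_prime ra (IHm (ltnW mp)))
  (residueV p_prime rb m0)) _.
by rewrite mulrAC divff // mul1r.
Qed.

(** The term [k = 0] is [-p t]. For [k > 0], [binom(p t, k) = (p t / k) binom(p t - 1, k - 1)], so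
    its cube carries [p^3], and the cofactors sum mod [p] to a multiple of
    [alternating_sum_inv_sq]. *)
Lemma gbsum_base t u : has_residue t u ->
  exists2 R, has_residue R 0 & gbsum (p%:R * t) p = - (p%:R * t) + p%:R ^+ 3 * R.
Proof.
move=> tu; have p0 := prime_gt0 p_prime.
exists (\sum_(1 <= k < p) (2 * k%:R - p%:R * t) *
    (t / k%:R * gbinom (p%:R * t - 1) k.-1) ^+ 3); last first.
  rewrite /gbsum big_ltn // gbinom0; congr (_ + _); first by ring.
  rewrite mulr_sumr; apply: eq_big_nat => -[//|k] /andP[_ kp].
  by rewrite gbinom_absorb /= -(natr1 k); ring.
pose G k : 'F_p := (2 * k%:R - p%:R * u) * (u / k%:R * (-1) ^+ k.-1) ^+ 3.
apply: (@eq_residue _ _ (\sum_(1 <= k < p) G k)).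
  apply: residue_sum => // -[//|k] kp.
  have k0 := Fp_natr_neq0 kp.
  apply: residueM => //.
    apply: residueD => //.
      exact: (residueM p_prime (residue_nat p 2) (residue_nat p _)).
    by apply: residueN => //; exact: (residueM p_prime (residue_nat p p) tu).
  apply: residueX => //; apply: residueM => //.
    exact: (residueM p_prime tu (residueV p_prime (residue_nat p _) k0)).
  by apply: (gbinom_pred_residue tu); case/andP: kp => _ /ltnW.
transitivity (2 * u ^+ 3 * \sum_(1 <= k < p) (-1) ^+ k.+1 / k%:R ^+ 2 : 'F_p).
  rewrite mulr_sumr; apply: eq_big_nat => -[//|k] kp; rewrite /G.
  have k0 := Fp_natr_neq0 kp; rewrite (pcharf0 charFp) mul0r subr0.
  rewrite exprMn -exprM mulnC exprM (_ : (-1) ^+ 3 = -1 :> 'F_p); last by ring.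
  rewrite !exprS /=; move: k0 ((-1) ^+ k); move: (k.+1%:R) => x x0 y.
  by field.
by rewrite alternating_sum_inv_sq // mulr0.
Qed.

(** Induction along [gbsum_pred]: [binom(a - 1, p - 1) = p binom(a, p) / a], so the boundary term
    affects only [R], adding [-2 u^3 / (m + 1)^2] mod [p]. *)
Lemma gbsum_residue t u m : has_residue t u -> (m < p)%N ->
  exists2 R, has_residue R (- 4 * u ^+ 3 * Q (2 * m%:R + 1)) &
    gbsum (m%:R + p%:R * t) p = (-1) ^+ m.+1 * (p%:R * t) + p%:R ^+ 3 * R.
Proof.
move=> tu; have p0 := prime_gt0 p_prime.
have pQ : p%:R != 0 :> rat by rewrite pnatr_eq0 -lt0n.
elim: m => [|m IHm] mp.
  have [R rR e] := gbsum_base tu; exists R; last by rewrite add0r e mulN1r.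
  by rewrite mulr0 add0r (appell1_1 charFp) // mulr0.
have m0 : m.+1%:R != 0 :> 'F_p by apply: Fp_natr_neq0; rewrite mp.
have [R rR e] := IHm (ltnW mp).
pose a : rat := m.+1%:R + p%:R * t.
have ra : has_residue a m.+1%:R.
  apply: eq_residue (residueD p_prime (residue_nat p m.+1)
    (residueM p_prime (residue_nat p p) tu)) _.
  by rewrite (pcharf0 charFp) mul0r addr0.
have a0 := residue_neq0 ra m0.
have ea : a - 1 = m%:R + p%:R * t by rewrite /a -natr1; ring.
have rC := residueM p_prime (gbinom_residue tu mp) (residueV p_prime ra m0).
have eC : gbinom (a - 1) p.-1 = p%:R * (gbinom a p / a).
  have := gbinom_absorb a p.-1; rewrite prednK // => ->; field.
  by rewrite a0.
have := gbsum_pred a p.-1; rewrite prednK // eC ea e => /(canRL (addrK _)) ->.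
exists ((p%:R - 2 * a) * (gbinom a p / a) ^+ 3 - R); last by rewrite !exprS; ring.
apply: eq_residue (residueD p_prime (residueM p_prime (residueD p_prime (residue_nat p p)
   (residueN p_prime (residueM p_prime (residue_nat p 2) ra))) (residueX p_prime 3 rC))
   (residueN p_prime rR)) _.
(* The shift relation at [y = 2 (m + 1)], with [y^(p-3)] written as [y^-2]. *)
have eQ : Q (2 * m.+1%:R + 1) = 2 / (2 * m.+1%:R) ^+ 2 - Q (2 * m%:R + 1).
  apply: (canRL (addrK _)); rewrite -natrM -(natr_expB3 charFp) //; last first.
    by rewrite natrM mulf_neq0 //; apply: Fp_natr_neq0; rewrite /= ltnW.
  rewrite -(appell1_shift p) natrM; congr (_ + appell _ _ _).
  by rewrite -natr1; ring.
rewrite eQ (pcharf0 charFp).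
have two0 : 2 != 0 :> 'F_p by apply: Fp_natr_neq0; rewrite /= ltnW.
by move: m0 (Q _); move: (m.+1%:R) => x x0 y; field; rewrite x0.
Qed.

(** The scalar [c] clears the denominator of [a]. Since [v] is [m] mod [p], the argument of [Q]
    depends on [a] alone. *)
Lemma pcongr_gbsum a m t c S Y Z (u v w : 'F_p) :
  a = m%:R + p%:R * t -> (m < p)%N ->
  has_residue t u -> has_residue a v -> has_residue c w ->
  has_residue Y (- 4 * w * u ^+ 3 * Q (2 * v + 1)) ->
  S = c * gbsum a p -> Z = (-1) ^+ m.+1 * c * (p%:R * t) + p%:R ^+ 3 * Y ->
  pcongr p 4 S Z.
Proof.
move=> ea mp tu av cw rY -> ->.
have [R rR eR] := gbsum_residue tu mp; rewrite ea eR mulrDr mulrCA -mulrA.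
rewrite [c * (p%:R ^+ 3 * R)]mulrCA; apply: (pcongr_residue p_prime 3 _ _ rY).
  by case: (cw) (tu) => pc _ [pt _]; rewrite !rpredM ?rpredX ?rpredN ?rpred1 ?rpred_nat.
have ev : v = m%:R.
  case: av => _ <-; rewrite ea.
  have [_ ->] := residueD p_prime (residue_nat p m) (residueM p_prime (residue_nat p p) tu).
  by rewrite (pcharf0 charFp) mul0r addr0.
by rewrite ev; apply: eq_residue (residueM p_prime cw rR) _; ring.
Qed.

(** Through [gbsum_cube], whose boundary term gives [-4 c t^3] at order [p^3]. The order-[p] part
    keeps [a] exact, as its residue would not suffice mod [p^4]. *)
Lemma pcongr_gbsum3 a m t c S Y Z (u v w : 'F_p) :
  a = m%:R + p%:R * t -> (m < p)%N ->
  has_residue t u -> has_residue a v -> has_residue c w ->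
  has_residue Y (12 * v ^+ 2 * w * u ^+ 3 * Q (2 * v + 1) - 4 * w * u ^+ 3) ->
  S = c * \sum_(0 <= k < p) (2 * k%:R - a) ^+ 3 * gbinom a k ^+ 3 ->
  Z = (-1) ^+ m * 3 * a ^+ 2 * c * (p%:R * t) + p%:R ^+ 3 * Y ->
  pcongr p 4 S Z.
Proof.
move=> ea mp tu av cw rY -> ->; rewrite gbsum_cube.
have [R rR eR] := gbsum_residue tu mp; rewrite -ea in eR.
have rG := gbinom_residue tu mp; rewrite -ea in rG.
rewrite eR (_ : c * _ = (-1) ^+ m * 3 * a ^+ 2 * c * (p%:R * t) +
    p%:R ^+ 3 * (- (3 * a ^+ 2 * c * R) - 4 * c * gbinom a p ^+ 3)); last first.
  by rewrite [(-1) ^+ m.+1]exprS; ring.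
have ev : v = m%:R.
  case: av => _ <-; rewrite ea.
  have [_ ->] := residueD p_prime (residue_nat p m) (residueM p_prime (residue_nat p p) tu).
  by rewrite (pcharf0 charFp) mul0r addr0.
apply: (pcongr_residue p_prime 3 _ _ rY).
  case: (av) (cw) (tu) => pa _ [pc _] [pt _].
  by rewrite !rpredM ?rpredX ?rpredN ?rpred1 ?rpred_nat.
apply: eq_residue (residueD p_prime (residueN p_prime (residueM p_prime (residueM p_prime
  (residueM p_prime (residue_nat p 3) (residueX p_prime 2 av)) cw) rR))
  (residueN p_prime (residueM p_prime (residueM p_prime (residue_nat p 4) cw)
  (residueX p_prime 3 rG)))) _.
by rewrite ev; ring.
Qed.

End Main.

(** * Specialization to the parameters -1/2, 1/2, -1/6 and -1/3 *)

Lemma gbinom_Nhalf_cube k :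
  gbinom (- (1 / 2)) k ^+ 3 = 'C(2 * k, k)%:R ^+ 3 / (- 64) ^+ k.
Proof.
rewrite gbinom_Nhalf expr_div_n -exprM [(k * 3)%N]mulnC exprM; congr (_ / _ ^+ k).
Qed.

Lemma gbinom_half_cube k : gbinom (1 / 2) k ^+ 3 =
  - ('C(2 * k, k)%:R ^+ 3 / ((- 64) ^+ k * (2 * k%:R - 1) ^+ 3)).
Proof.
rewrite gbinom_half [LHS]exprNn expr_div_n exprMn -exprM [(k * 3)%N]mulnC exprM.
by rewrite (_ : (-1) ^+ 3 = -1 :> rat) ?mulN1r.
Qed.

Lemma signr_eq_odd (m n : nat) : odd m = odd n -> (-1) ^+ m = (-1) ^+ n :> rat.
Proof. by move=> e; rewrite -[LHS]signr_odd e signr_odd. Qed.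

(** [(p - 1) / 2 = 3 j] has the parity of [j], the residue of [-1/6] mod [p]. *)
Lemma mod6_eq1 p : odd p -> (3 %| p - 1)%N -> exists j, [/\ p = (6 * j + 1)%N,
  p%:R = 6 * j%:R + 1 :> rat & (-1) ^+ ((p - 1) %/ 2) = (-1) ^+ j :> rat].
Proof.
move=> op dp; have ep : p = (6 * (p %/ 6) + 1)%N by lia.
exists (p %/ 6)%N; split=> //; first by rewrite {1}ep natrD natrM.
by apply: signr_eq_odd; lia.
Qed.

Lemma mod6_eq5 p : odd p -> (3 %| p - 2)%N -> (1 < p)%N ->
  exists j, [/\ p = (6 * j + 5)%N, p%:R = 6 * j%:R + 5 :> rat &
    (-1) ^+ ((p - 1) %/ 2) = (-1) ^+ (5 * j + 4) :> rat].
Proof.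
move=> op dp p1; have ep : p = (6 * (p %/ 6) + 5)%N by lia.
exists (p %/ 6)%N; split=> //; first by rewrite {1}ep natrD natrM.
by apply: signr_eq_odd; lia.
Qed.

Theorem theorem4p2 (p : nat) (p_gt3 : (3 < p)%N) (p_prime : prime p) :
  let P : rat := p%:R in
  let E : rat := (euler_number (p - 3))%:~R in
  let U : rat := (U_number (p - 3))%:~R in
  let s : rat := (-1) ^+ ((p - 1) %/ 2) in
  pcongr p 4
    (\sum_(0 <= k < p)
       (4 * k%:R + 1) ^+ 3 * (('C(2 * k, k))%:R ^+ 3 / (- 64) ^+ k))
    (- 3 * s * P + P ^+ 3 * (4 - 3 * E))
  /\
  pcongr p 4
    (\sum_(0 <= k < p)
       (4 * k%:R - 1) *
       (('C(2 * k, k))%:R ^+ 3 / ((- 64) ^+ k * (2 * k%:R - 1) ^+ 3)))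
    (s * P + P ^+ 3 * (E - 2))
  /\
  pcongr p 4
    (\sum_(0 <= k < p)
       (4 * k%:R - 1) ^+ 3 *
       (('C(2 * k, k))%:R ^+ 3 / ((- 64) ^+ k * (2 * k%:R - 1) ^+ 3)))
    (- 3 * s * P + P ^+ 3 * (2 - 3 * E))
  /\
  (((3 %| p - 1)%N ->
    pcongr p 4
      (\sum_(0 <= k < p) (12 * k%:R + 1) * gbinom (- (1 / 6)) k ^+ 3)
      (s * P + 5 / 9 * P ^+ 3 * E))
   /\
   ((3 %| p - 2)%N ->
    pcongr p 4
      (\sum_(0 <= k < p) (12 * k%:R + 1) * gbinom (- (1 / 6)) k ^+ 3)
      (5 * s * P + 625 / 9 * P ^+ 3 * E)))
  /\
  (((3 %| p - 1)%N ->
    pcongr p 4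
      (\sum_(0 <= k < p) (12 * k%:R + 1) ^+ 3 * gbinom (- (1 / 6)) k ^+ 3)
      (- 3 * s * P + P ^+ 3 * (4 - 5 / 3 * E)))
   /\
   ((3 %| p - 2)%N ->
    pcongr p 4
      (\sum_(0 <= k < p) (12 * k%:R + 1) ^+ 3 * gbinom (- (1 / 6)) k ^+ 3)
      (- 15 * s * P + P ^+ 3 * (500 - 625 / 3 * E))))
  /\
  (((3 %| p - 1)%N ->
    pcongr p 4
      (\sum_(0 <= k < p) (6 * k%:R + 1) * gbinom (- (1 / 3)) k ^+ 3)
      (P + P ^+ 3 * U))
   /\
   ((3 %| p - 2)%N ->
    pcongr p 4
      (\sum_(0 <= k < p) (6 * k%:R + 1) * gbinom (- (1 / 3)) k ^+ 3)
      (- 2 * P + 8 * P ^+ 3 * U)))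
  /\
  (((3 %| p - 1)%N ->
    pcongr p 4
      (\sum_(0 <= k < p) (6 * k%:R + 1) ^+ 3 * gbinom (- (1 / 3)) k ^+ 3)
      (- 3 * P + P ^+ 3 * (4 - 3 * U)))
   /\
   ((3 %| p - 2)%N ->
    pcongr p 4
      (\sum_(0 <= k < p) (6 * k%:R + 1) ^+ 3 * gbinom (- (1 / 3)) k ^+ 3)
      (6 * P + 8 * P ^+ 3 * (4 - 3 * U)))).
Proof.
move=> P E U s.
have p_odd : odd p := odd_pchar (pchar_Fp p_prime) p_gt3.
have two0 : 2 != 0 :> 'F_p by apply: Fp_natr_neq0; rewrite //= ltnW.
have three0 : 3 != 0 :> 'F_p by apply: Fp_natr_neq0.
have six0 : 6 != 0 :> 'F_p by rewrite (natrM _ 2 3) mulf_neq0.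
have nine0 : 9 != 0 :> 'F_p by rewrite (natrM _ 3 3) mulf_neq0.
have four0 : 4 != 0 :> 'F_p by rewrite (natrM _ 2 2) mulf_neq0.
pose e : 'F_p := (euler_number (p - 3))%:~R.
pose u : 'F_p := (U_number (p - 3))%:~R.
have rE : has_residue E e := residue_int p _.
have rU : has_residue U u := residue_int p _.
have r1 : @has_residue p 1 1 := residue_nat p 1.
have rV d : d%:R != 0 :> 'F_p -> @has_residue p d%:R^-1 d%:R^-1.
  exact: (residueV p_prime (residue_nat p d)).
pose rM := @residueM p p_prime; pose rD := @residueD p p_prime.
pose rN := @residueN p p_prime; pose rn := residue_nat p.
have rhalf : @has_residue p (1 / 2) (1 / 2) := rM _ _ _ _ r1 (rV 2 two0).
have rthird : @has_residue p (1 / 3) (1 / 3) := rM _ _ _ _ r1 (rV 3 three0).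
have rsixth : @has_residue p (1 / 6) (1 / 6) := rM _ _ _ _ r1 (rV 6 six0).
pose Q := @appell 'F_p 1 (p - 3).
have charFp := pchar_Fp p_prime.
have Q0 : Q 0 = e by exact: appell0.
(* The arguments [2a + 1] are 0, 2, 2/3 and 1/3 for [a] equal to -1/2, 1/2, -1/6 and -1/3. *)
have Qhalf : Q (2 * - (1 / 2) + 1) = e by rewrite -Q0; congr Q; field.
have Qhalf' : Q (2 * (1 / 2) + 1) = 2 - e.
  by rewrite -Q0 -(appell1_2 _ p); congr (appell _ _ _); field.
have Qsixth : Q (2 * - (1 / 6) + 1) = 5 * e.
  rewrite -Q0 -(appell1_two_thirds charFp) //; congr (appell _ _ _); field.
  by rewrite ?three0.
have Qthird : Q (2 * - (1 / 3) + 1) = 9 / 4 * u.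
  rewrite -[u](appell0 _ 2) -(appell1_third charFp) //; congr (appell _ _ _); field.
  by rewrite ?three0.
have twoQ : 2 != 0 :> rat by [].
have [h eh] : exists h, p = (2 * h + 1)%N.
  by exists p./2; rewrite -[LHS]odd_double_half p_odd mul2n addnC.
have es : s = (-1) ^+ h by rewrite /s eh addnK mulKn.
have ehQ : p%:R = 2 * h%:R + 1 :> rat by rewrite eh natrD natrM.
have hNhalf := rN _ _ rhalf.
split.
  (* [-1/2 = h + p (-1/2)] and [(4k + 1)^3 = 8 (2k + 1/2)^3]. The goals left, here and below, are
     this splitting, [m < p], the residue of [Y], and the shapes of [S] and [Z]. *)
  apply: (@pcongr_gbsum3 p p_prime p_gt3 (- (1 / 2)) h (- (1 / 2)) 8 _ (4 - 3 * E)
    _ _ _ _ _ _ hNhalf hNhalf (rn 8)).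
  - by rewrite ehQ; field.
  - by rewrite eh; clear; lia.
  - apply: eq_residue (rD _ _ _ _ (rn 4) (rN _ _ (rM _ _ _ _ (rn 3) rE))) _.
    by rewrite -/Q Qhalf; field.
  - rewrite mulr_sumr; apply: eq_bigr => k _; rewrite -gbinom_Nhalf_cube.
    by field.
  - by rewrite es; field.
split.
  (* [1/2 = (h + 1) + p (-1/2)]; the scalar is negative because of the sign in
     [gbinom_half_cube]. *)
  apply: (@pcongr_gbsum p p_prime p_gt3 (1 / 2) h.+1 (- (1 / 2)) (- 2) _ (E - 2)
    _ _ _ _ _ _ hNhalf rhalf (rN _ _ (rn 2))).
  - by rewrite ehQ -natr1; field.
  - by move: p_gt3; rewrite eh; clear; lia.
  - apply: eq_residue (rD _ _ _ _ rE (rN _ _ (rn 2))) _.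
    by rewrite -/Q Qhalf'; field.
  - rewrite mulr_sumr; apply: eq_bigr => k _; rewrite gbinom_half_cube.
    by move: (_ / _) => x; field.
  - by rewrite es !exprS; field.
split.
  apply: (@pcongr_gbsum3 p p_prime p_gt3 (1 / 2) h.+1 (- (1 / 2)) (- 8) _ (2 - 3 * E)
    _ _ _ _ _ _ hNhalf rhalf (rN _ _ (rn 8))).
  - by rewrite ehQ -natr1; field.
  - by move: p_gt3; rewrite eh; clear; lia.
  - apply: eq_residue (rD _ _ _ _ (rn 2) (rN _ _ (rM _ _ _ _ (rn 3) rE))) _.
    by rewrite -/Q Qhalf'; field.
  - rewrite mulr_sumr; apply: eq_bigr => k _; rewrite gbinom_half_cube.
    by move: (_ / _) => x; field.
  - by rewrite es !exprS; field.
(* For [a = -1/3] the representative [m] is [2j] or [4j + 3], of fixed parity, so no sign depending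
   on [p] survives. *)
have sgn2 j : (-1) ^+ (2 * j) = 1 :> rat by rewrite exprM sqrrN !expr1n.
have sgn3 j : (-1) ^+ (4 * j + 3) = -1 :> rat.
  by apply: (@signr_eq_odd _ 1); rewrite oddD oddM.
have hNsixth := rN _ _ rsixth; have hNthird := rN _ _ rthird.
have r5sixth : @has_residue p (- (5 / 6)) (- (5 / 6)).
  exact: rN _ _ (rM _ _ _ _ (rn 5) (rV 6 six0)).
have r2third : @has_residue p (- (2 / 3)) (- (2 / 3)).
  exact: rN _ _ (rM _ _ _ _ (rn 2) (rV 3 three0)).
split.
  split=> [/(mod6_eq1 p_odd)|/(mod6_eq5 p_odd)/(_ (prime_gt1 p_prime))] [j [ej ejQ ejs]].
  - apply: (@pcongr_gbsum p p_prime p_gt3 (- (1 / 6)) j (- (1 / 6)) 6 _ (5 / 9 * E)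
      _ _ _ _ _ _ hNsixth hNsixth (rn 6)).
    + by rewrite ?natrD ?natrM ejQ; field.
    + by rewrite ej; clear; lia.
    + apply: eq_residue (rM _ _ _ _ (rM _ _ _ _ (rn 5) (rV 9 nine0)) rE) _.
      by rewrite -/Q Qsixth; field; rewrite ?two0 ?three0 ?four0 ?six0 ?nine0.
    + rewrite mulr_sumr; apply: eq_bigr => k _.
      by move: (gbinom _ _) => x; field.
    + by rewrite [(-1) ^+ _]exprS -ejs /P /s; field.
  (* [-1/6 = (5j + 4) + p (-5/6)]; against the previous case, [t^3] contributes a factor 125. *)
  - apply: (@pcongr_gbsum p p_prime p_gt3 (- (1 / 6)) (5 * j + 4) (- (5 / 6)) 6 _ (625 / 9 * E)
      _ _ _ _ _ _ r5sixth hNsixth (rn 6)).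
    + by rewrite ?natrD ?natrM ejQ; field.
    + by rewrite ej; clear; lia.
    + apply: eq_residue (rM _ _ _ _ (rM _ _ _ _ (rn 625) (rV 9 nine0)) rE) _.
      by rewrite -/Q Qsixth; field; rewrite ?two0 ?three0 ?four0 ?six0 ?nine0.
    + rewrite mulr_sumr; apply: eq_bigr => k _.
      by move: (gbinom _ _) => x; field.
    + by rewrite [(-1) ^+ _]exprS -ejs /P /s; field.
split.
  split=> [/(mod6_eq1 p_odd)|/(mod6_eq5 p_odd)/(_ (prime_gt1 p_prime))] [j [ej ejQ ejs]].
  - apply: (@pcongr_gbsum3 p p_prime p_gt3 (- (1 / 6)) j (- (1 / 6)) 216 _ (4 - 5 / 3 * E)
      _ _ _ _ _ _ hNsixth hNsixth (rn 216)).
    + by rewrite ?natrD ?natrM ejQ; field.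
    + by rewrite ej; clear; lia.
    + apply: eq_residue (rD _ _ _ _ (rn 4) (rN _ _ (rM _ _ _ _
        (rM _ _ _ _ (rn 5) (rV 3 three0)) rE))) _.
      by rewrite -/Q Qsixth; field; rewrite ?two0 ?three0 ?four0 ?six0 ?nine0.
    + rewrite mulr_sumr; apply: eq_bigr => k _.
      by move: (gbinom _ _) => x; field.
    + by rewrite -ejs /P /s; field.
  - apply: (@pcongr_gbsum3 p p_prime p_gt3 (- (1 / 6)) (5 * j + 4) (- (5 / 6)) 216 _
      (500 - 625 / 3 * E)
      _ _ _ _ _ _ r5sixth hNsixth (rn 216)).
    + by rewrite ?natrD ?natrM ejQ; field.
    + by rewrite ej; clear; lia.
    + apply: eq_residue (rD _ _ _ _ (rn 500) (rN _ _ (rM _ _ _ _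
        (rM _ _ _ _ (rn 625) (rV 3 three0)) rE))) _.
      by rewrite -/Q Qsixth; field; rewrite ?two0 ?three0 ?four0 ?six0 ?nine0.
    + rewrite mulr_sumr; apply: eq_bigr => k _.
      by move: (gbinom _ _) => x; field.
    + by rewrite -ejs /P /s; field.
split.
  split=> [/(mod6_eq1 p_odd)|/(mod6_eq5 p_odd)/(_ (prime_gt1 p_prime))] [j [ej ejQ ejs]].
  - apply: (@pcongr_gbsum p p_prime p_gt3 (- (1 / 3)) (2 * j) (- (1 / 3)) 3 _ (U)
      _ _ _ _ _ _ hNthird hNthird (rn 3)).
    + by rewrite ?natrD ?natrM ejQ; field.
    + by rewrite ej; clear; lia.
    + apply: eq_residue (rU) _.
      by rewrite -/Q Qthird; field; rewrite ?two0 ?three0 ?four0 ?six0 ?nine0.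
    + rewrite mulr_sumr; apply: eq_bigr => k _.
      by move: (gbinom _ _) => x; field.
    + by rewrite [(-1) ^+ _]exprS sgn2 /P; field.
  (* [-1/3 = (4j + 3) + p (-2/3)]; the factor 8 is the cube of the ratio of the two values of
     [t]. *)
  - apply: (@pcongr_gbsum p p_prime p_gt3 (- (1 / 3)) (4 * j + 3) (- (2 / 3)) 3 _ (8 * U)
      _ _ _ _ _ _ r2third hNthird (rn 3)).
    + by rewrite ?natrD ?natrM ejQ; field.
    + by rewrite ej; clear; lia.
    + apply: eq_residue (rM _ _ _ _ (rn 8) rU) _.
      by rewrite -/Q Qthird; field; rewrite ?two0 ?three0 ?four0 ?six0 ?nine0.
    + rewrite mulr_sumr; apply: eq_bigr => k _.
      by move: (gbinom _ _) => x; field.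
    + by rewrite [(-1) ^+ _]exprS sgn3 /P; field.
split=> [/(mod6_eq1 p_odd)|/(mod6_eq5 p_odd)/(_ (prime_gt1 p_prime))] [j [ej ejQ ejs]].
  - apply: (@pcongr_gbsum3 p p_prime p_gt3 (- (1 / 3)) (2 * j) (- (1 / 3)) 27 _ (4 - 3 * U)
      _ _ _ _ _ _ hNthird hNthird (rn 27)).
    + by rewrite ?natrD ?natrM ejQ; field.
    + by rewrite ej; clear; lia.
    + apply: eq_residue (rD _ _ _ _ (rn 4) (rN _ _ (rM _ _ _ _ (rn 3) rU))) _.
      by rewrite -/Q Qthird; field; rewrite ?two0 ?three0 ?four0 ?six0 ?nine0.
    + rewrite mulr_sumr; apply: eq_bigr => k _.
      by move: (gbinom _ _) => x; field.
    + by rewrite sgn2 /P; field.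
  - apply: (@pcongr_gbsum3 p p_prime p_gt3 (- (1 / 3)) (4 * j + 3) (- (2 / 3)) 27 _
      (8 * (4 - 3 * U))
      _ _ _ _ _ _ r2third hNthird (rn 27)).
    + by rewrite ?natrD ?natrM ejQ; field.
    + by rewrite ej; clear; lia.
    + apply: eq_residue (rM _ _ _ _ (rn 8) (rD _ _ _ _ (rn 4) (rN _ _ (rM _ _ _ _ (rn 3) rU)))) _.
      by rewrite -/Q Qthird; field; rewrite ?two0 ?three0 ?four0 ?six0 ?nine0.
    + rewrite mulr_sumr; apply: eq_bigr => k _.
      by move: (gbinom _ _) => x; field.
    + by rewrite sgn3 /P; field.
Qed.
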